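(* Let $G$ be a Dyck graph on the vertex set $[n]$. Then, in $\mathbf{WQSym}$, $$(t-1)^n\, \mathbf{X}_G\left(t, \frac{A|}{|t-1}\right) = \sum_{u\in \mathrm{PW}_n} t^{\mathrm{asc}_G(u)}\,\mathbf{M}_u(A).$$
   Context: $\mathbb{K}$ is a field of characteristic $0$ containing all formal series in the formal parameter $t$ that are used (in particular it contains $\mathbb{Q}(t)$). A Dyck graph is a simple undirected graph $G$ with vertex set $V(G)=[n]=\{1,\dots,n\}$ and edge set $E(G)$, edges written as pairs $(i,j)$ with $i<j$, such that $(i,j)\in E(G)$ implies $(i',j')\in E(G)$ for all $i\le i'<j'\le j$. Let $A=\{a_1<a_2<\cdots\}$ be an infinite totally ordered alphabet of noncommuting letters. For a word $w$ over a totally ordered alphabet, with distinct letters $b_1<\cdots<b_r$, $\mathrm{pack}(w)$ is the word obtained by replacing each $b_i$ by $i$. A word $u$ of positive integers is packed if $\mathrm{pack}(u)=u$; $\mathrm{PW}_n$ is the set of packed words of length $n$, and $\max(u)$ is the largest letter of $u$. For a packed word $u$, $\mathrm{ev}(u)$ is the composition $(|u|_1,|u|_2,\dots)$ recording the number of occurrences of each letter. $\mathbf{M}_u=\mathbf{M}_u(A)=\sum_{\mathrm{pack}(w)=u} w$ (sum over words $w\in A^*$). $\mathbf{WQSym}$ is the algebra with linear basis $(\mathbf{M}_u)$, $u$ packed, inside the formal series of bounded degree over $A$. A packed word $u=u_1\cdots u_n$ is regarded as a coloring of $G$ (vertex $i$ has color $u_i$). It is proper if $u_i\ne u_j$ whenever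 $(i,j)\in E(G)$; $\mathrm{PC}(G)$ is the set of proper packed colorings. $\mathrm{asc}_G(u)$ is the number of edges $(i<j)$ of $G$ with $u_i<u_j$. Define $$\mathbf{X}_G(t,A)=\sum_{c\in \mathrm{PC}(G)} t^{\mathrm{asc}_G(c)}\,\mathbf{M}_c(A).$$ The transformation $A\mapsto \frac{A|}{|t-1}$: for a parameter $q$ commuting with the letters, $\frac{A|}{|1-q}$ is the alphabet $\{a_iq^j\mid i\ge1,j\ge0\}$ with the total order $a_iq^j<a_kq^l$ iff $i<k$, or $i=k$ and $j>l$; this defines $\mathbf{M}_u\left(\frac{A|}{|1-q}\right)$, which lies in $\mathbf{WQSym}$ with coefficients rational in $q$. Since $t-1=t(1-t^{-1})$, for $u$ of length $n$ one sets $\mathbf{M}_u\left(\frac{A|}{|t-1}\right)=t^{-n}\,\mathbf{M}_u\left(\frac{A|}{|1-q}\right)\big|_{q=t^{-1}}$, extended linearly. Explicitly, say that $u$ is finer than $v$ (packed words of the same length) if for all $i,j$: $u_i=u_j\Rightarrow v_i=v_j$ and $u_i>u_j\Rightarrow v_i\ge v_j$. Then $$\mathbf{M}_u\left(\tfrac{A|}{|t-1}\right)=\sum_{v:\ u \text{ finer than } v}\ \prod_{k=1}^{\max(v)} M_{\mathrm{ev}(u^{(k)})}\left(\tfrac1{t-1}\right)\ \mathbf{M}_v(A),$$ where $u^{(k)}$ is the packing of the subword of $u$ at the positions $j$ with $v_j=k$, and for a composition $I=(i_1,\dots,i_r)$, $M_I\left(\tfrac{1}{t-1}\right)=\prod_{k=1}^r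 \frac{1}{t^{i_1+\cdots+i_k}-1}$. *)

(* Defs.v *)
From HB Require Import structures.
From mathcomp Require Import all_boot all_order all_algebra.
From mathcomp Require Import all_classical.

Set Implicit Arguments.
Unset Strict Implicit.
Unset Printing Implicit Defensive.

Import Order.TTheory GRing.Theory.
Local Open Scope ring_scope.

Definition pack {d : Order.disp_t} {T : orderType d} (w : seq T) : seq nat :=
  [seq (index x (sort <=%O (undup w))).+1 | x <- w].

Definition packed (u : seq nat) : bool := pack u == u.

(* A packed word of length n only uses letters in {1, ..., n}, so it is an    *)
(* n-tuple over 'I_n.+1 (in which the letter 0 never occurs).                 *)
Definition word {n : nat} (u : n.-tuple 'I_n.+1) : seq nat := map val u.

Definition PW (n : nat) : {set n.-tuple 'I_n.+1} := [set u | packed (word u)].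

(* The vertices 1, ..., n are the elements 0, ..., n-1 of 'I_n.               *)
Definition dyck_graph (n : nat) (G : rel 'I_n) : Prop :=
  [/\ symmetric G, irreflexive G &
      forall i j i' j' : 'I_n, (i < j)%N -> G i j ->
        (i <= i')%N -> (i' < j')%N -> (j' <= j)%N -> G i' j'].

Definition proper_coloring {n : nat} (G : rel 'I_n) (u : n.-tuple 'I_n.+1) :
    bool :=
  [forall i, forall j, G i j ==> (tnth u i != tnth u j)].

Definition PC {n : nat} (G : rel 'I_n) : {set n.-tuple 'I_n.+1} :=
  [set u in PW n | proper_coloring G u].

Definition asc {n : nat} (G : rel 'I_n) (u : n.-tuple 'I_n.+1) : nat :=
  #|[set e : 'I_n * 'I_n |
      [&& (e.1 < e.2)%N, G e.1 e.2 & (tnth u e.1 < tnth u e.2)%N]]|.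

(* Noncommutative formal series over A = {a_0 < a_1 < ...}: the word          *)
(* a_(i1) ... a_(in) is the sequence [:: i1; ...; in], and a series is the    *)
(* function sending each word to its coefficient.                             *)
Notation series K := (seq nat -> (K : fieldType)^o).

Definition M (K : fieldType) (u : seq nat) : series K :=
  fun w => (pack w == u)%:R.

Definition chromatic {K : fieldType} (t : K) {n : nat} (G : rel 'I_n) :
    series K :=
  \sum_(c in PC G) t ^+ asc G c *: M K (word c).

(* The letter a_i q^j of A|/|(1-q) is the pair (i, j) of nat *l nat^d: the    *)
(* order is lexicographic, with decreasing exponents j.                       *)
(* The coefficient of q^m w in M_u(A|/|(1-q)): the number of words            *)
(* (a_(w1) q^(j1)) ... (a_(wn) q^(jn)) with j1 + ... + jn = m whose packing   *)
(* is u. All the exponents in such a word are at most m.                      *)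
Definition M_q_coef (u w : seq nat) (m : nat) : nat :=
  #|[set js : (size w).-tuple 'I_m.+1 |
      (sumn (map val js) == m) &&
      (pack (zip w (map val js) : seq (nat *l nat^d)) == u)]|.

Definition peval {K : fieldType} (P : {poly int}) (x : K) : K :=
  (map_poly intr P).[x].

(* The power series \sum_m c_m q^m is the expansion of a rational function    *)
(* P(q) / Q(q) whose value at q = x is y.                                     *)
Definition rational_value {K : fieldType} (c : nat -> nat) (x y : K) : Prop :=
  exists P Q : {poly int},
    [/\ forall m, \sum_(k < m.+1) Q`_k * (c (m - k)%N)%:Z = P`_m,
        peval Q x != 0 & y = peval P x / peval Q x].

Lemma rational_value_unique {K : fieldType} (c : nat -> nat) (x y y' : K) :
  rational_value c x y -> rational_value c x y' -> y = y'.
Proof.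
move=> [P [Q [PQ Qx ->]]] [P' [Q' [PQ' Q'x ->]]].
suff E : P * Q' = P' * Q.
  have /(congr1 (@peval K ^~ x)) := E.
  by rewrite /peval !rmorphM !hornerM => E'; apply/eqP; rewrite eqr_div ?E'.
have aux (A B D : {poly int}) m :
    (forall i, \sum_(k < i.+1) B`_k * (c (i - k)%N)%:Z = A`_i) ->
    (A * D)`_m = (B * (\poly_(i < m.+1) (c i)%:Z) * D)`_m.
  move=> AB; rewrite !coefM; apply: eq_bigr => i _; congr (_ * _).
  rewrite -AB coefM; apply: eq_bigr => k _; rewrite coef_poly.
  by rewrite (leq_ltn_trans (leq_subr _ _)) ?ltn_ord.
apply/polyP => m; rewrite (aux _ _ _ _ PQ) (aux _ _ _ _ PQ').
by rewrite mulrAC -!mulrA mulrCA !mulrA [Q' * Q * _]mulrAC.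
Qed.

Definition spec {K : fieldType} (c : nat -> nat) (x : K) : K :=
  xget 0 [set y | rational_value c x y].

(* M_u(A|/|(t-1)) = t^(-|u|) M_u(A|/|(1-q)) at q = 1/t.                       *)
Definition M_subst {K : fieldType} (t : K) (u : seq nat) : series K :=
  fun w => t ^- size u * spec (M_q_coef u w) t^-1.

(* The transformation F(A) |-> F(A|/|(t-1)), i.e. the linear extension of     *)
(* M_u |-> M_subst t u. The coefficient of M_u in F is F u, and only the M_u  *)
(* with |u| = |w| contribute to the coefficient of w (see the lemmas below).  *)
Definition alphabet_subst {K : fieldType} (t : K) (F : series K) : series K :=
  fun w => \sum_(u in PW (size w)) F (word u) * M_subst t (word u) w.

Lemma alphabet_subst_linear {K : fieldType} (t : K) :
  linear (@alphabet_subst K t).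
Proof.
move=> a F F'; apply/funext => w.
transitivity (a * alphabet_subst t F w + alphabet_subst t F' w); last by [].
rewrite /alphabet_subst big_distrr -big_split; apply: eq_bigr => u _ /=.
by rewrite [LHS]mulrDl -mulrA.
Qed.

Lemma size_pack {d : Order.disp_t} {T : orderType d} (w : seq T) :
  size (pack w) = size w.
Proof. by rewrite size_map. Qed.

Lemma pack_letter {d : Order.disp_t} {T : orderType d} (w : seq T) x :
  x \in pack w -> (x < (size w).+1)%N.
Proof.
move=> /mapP[y yw ->]; rewrite ltnS; apply: leq_trans (size_undup w).
by rewrite -(size_sort <=%O) index_mem mem_sort mem_undup.
Qed.

Lemma M_q_coef_size u w m : size u != size w -> M_q_coef u w m = 0%N.
Proof.
move=> neq; apply/eqP; rewrite cards_eq0; apply/eqP/setP => js.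
rewrite inE finset.in_set0; apply/negP => /andP[_ /eqP E].
by move: neq; rewrite -E size_pack size_zip size_map size_tuple minnn eqxx.
Qed.

Lemma spec0 {K : fieldType} (c : nat -> nat) (x : K) :
  (forall m, c m = 0%N) -> spec c x = 0.
Proof.
move=> c0; rewrite /spec; case: xgetP => [y _ /= yP|] //.
apply: (rational_value_unique yP); exists 0, 1; split.
- by move=> m; rewrite coef0 big1 // => k _; rewrite c0 mulr0.
- by rewrite /peval rmorph1 hornerC oner_eq0.
- by rewrite /peval rmorph0 horner0 mul0r.
Qed.

Lemma alphabet_subst_M {K : fieldType} (t : K) (u : seq nat) :
  packed u -> alphabet_subst t (M K u) = M_subst t u.
Proof.
move=> pu; apply/funext => w; rewrite /alphabet_subst.
have [szu|szu] := eqVneq (size u) (size w); last first.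
  rewrite {2}/M_subst spec0 ?mulr0; last by move=> m; apply: M_q_coef_size.
  rewrite big1 // => v; rewrite inE => /eqP pv.
  rewrite /M pv; case: eqP => [E|_]; last by rewrite mul0r.
  by move: szu; rewrite -E /word size_map size_tuple eqxx.
have szv : size [seq inord x : 'I_(size w).+1 | x <- u] == size w.
  by rewrite size_map szu.
have wv : word (Tuple szv) = u.
  rewrite /word /= -map_comp -[RHS]map_id; apply/eq_in_map => x xu /=.
  by rewrite inordK // -szu pack_letter // (eqP pu).
rewrite (bigD1 (Tuple szv)) /=; last by rewrite inE wv.
rewrite wv /M (eqP pu) eqxx mul1r big1 ?addr0 // => v /andP[].
rewrite inE => /eqP pv nv; rewrite pv; case: eqP => [E|_]; last by rewrite mul0r.
case/negP: nv; apply/eqP/val_inj; apply: (inj_map val_inj).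
by rewrite [LHS]E -[LHS]wv.
Qed.

(* Main.v *)
Require Import Defs.
From mathcomp Require Import all_boot all_order all_algebra.
From mathcomp Require Import all_classical.
From mathcomp Require Import fintype finset zify ring.

Import Order.TTheory GRing.Theory.
Local Open Scope ring_scope.

Set Implicit Arguments.
Unset Strict Implicit.
Unset Printing Implicit Defensive.

(** Compare the coefficients of a word [s] of length [n]. Before [q] is set to
    [1/t], the left-hand side is, up to a power of [t] and of [t - 1], the
    power series in [q]
      F(q) = sum over exponents j : [n] -> N of  t^asc(j) q^|j|,
    over those [j] for which the coloring of [G] by the letters
    [a_(s i) q^(j i)] is proper, [asc] counting the ascents of this coloring:
    indeed each [j] contributes to exactly one [M_u], the one where [u] is the
    packing of these letters ([pattern_sum]). So everything reduces to showing
    that [F] is rational with value [(t / (t - 1))^n t^asc(s)] at [q = 1/t].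

    Generalize [F] to [F_D], for a set [D] of vertices. Let [B] be the set of
    vertices of [D] whose letter in [s] is the largest. As the powers of [q]
    are in decreasing order, the vertices of [B] with exponent [0], if any,
    carry the largest letter of the coloring. Let [S] be the set of these
    vertices; erasing them and lowering by one the other exponents on [B] gives
      F_D = sum over S included in B of  a(D, S) q^(|B| - |S|) F_(D - S),
    where [a(D, S)] is the contribution of the edges that meet [S]
    ([weight_sum_rec]). The term of the empty [S] is [q^|B| F_D], so that this
    recursion determines [F_D] and shows that it is rational, with a
    denominator that does not vanish at [1/t] because [t] is not a root of
    unity. The same recursion holds for any weight that is a product of local
    factors depending only on the relative order of pairs of letters: the
    series attached to a single [M_u], whose value at [1/t] enters in the
    definition of the substitution, is another instance ([pattern_weight]).

    It remains to check that the announced value satisfies the recursion at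
    [q = 1/t] ([chromatic_value]). The ascents of [s] factor out
    ([zero_weight_asc]) and there remains an identity on the subgraph induced
    by [B],
      sum over S independent of  (t - 1)^|S| t^#{edges i < i' with i' in S}
        = t^|B|,
    which holds for Dyck graphs by removal of the last vertex
    ([sum_down_weight]). *)

(** * Power series that are expansions of rational functions *)

Section RationalSeries.
Variables (R : comNzRingType) (K : fieldType) (phi : {rmorphism R -> K}) (x : K).
Implicit Types (P Q : {poly R}) (c d : nat -> R).

Definition expansion Q c P : Prop :=
  forall m, \sum_(k < m.+1) Q`_k * c (m - k)%N = P`_m.

Definition eval P : K := (map_poly phi P).[x].

Lemma evalM P Q : eval (P * Q) = eval P * eval Q.
Proof. by rewrite /eval rmorphM hornerM. Qed.

Lemma evalD P Q : eval (P + Q) = eval P + eval Q.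
Proof. by rewrite /eval rmorphD hornerD. Qed.

(** With [phi] the map from the integers this is [rational_value]; with [phi]
    the identity of a field, series with arbitrary coefficients, such as linear
    combinations of the former, can be compared as well. *)
Definition ratval c (y : K) : Prop :=
  exists P Q, [/\ expansion Q c P, eval Q != 0 & y = eval P / eval Q].

Definition shift (e : nat) c : nat -> R :=
  fun m => if (m < e)%N then 0 else c (m - e)%N.

(** Up to a given degree a series is a polynomial, which reduces the calculus
    of expansions to associativity and distributivity in [{poly R}]. *)
Lemma expansion_trunc Q c P :
  expansion Q c P <->
  forall m N, (m < N)%N -> (Q * \poly_(i < N) c i)`_m = P`_m.
Proof.
have E m N : (m < N)%N ->
    (Q * \poly_(i < N) c i)`_m = \sum_(k < m.+1) Q`_k * c (m - k)%N.
  move=> mN; rewrite coefM; apply: eq_bigr => k _.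
  by rewrite coef_poly (leq_ltn_trans (leq_subr _ _) mN).
by split=> [H m N mN|H m]; [rewrite E ?H | rewrite -(E m m.+1) ?H].
Qed.

Lemma expansion_mull Q' Q c P :
  expansion Q c P -> expansion (Q' * Q) c (Q' * P).
Proof.
move/expansion_trunc=> H; apply/expansion_trunc => m N mN.
rewrite -mulrA !coefM; apply: eq_bigr => i _; rewrite H //.
exact: leq_ltn_trans (leq_subr _ _) mN.
Qed.

Lemma ratval_ext c d y : c =1 d -> ratval c y -> ratval d y.
Proof.
move=> cd [P [Q [H Q0 yE]]]; exists P, Q; split=> // m.
by rewrite -H; apply: eq_bigr => k _; rewrite cd.
Qed.

Lemma ratval_unique c y y' : ratval c y -> ratval c y' -> y = y'.
Proof.
move=> [P [Q [H Q0 ->]]] [P' [Q' [H' Q0' ->]]].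
have /(congr1 eval) : Q' * P = Q * P'.
  apply/polyP => m; rewrite -(expansion_mull Q' H) -(expansion_mull Q H').
  by rewrite mulrC.
rewrite !evalM => E; apply/eqP; rewrite eqr_div //.
by rewrite mulrC E mulrC.
Qed.

Lemma ratval0 : ratval (fun=> 0) 0.
Proof.
exists 0, 1; split; rewrite /eval ?rmorph1 ?hornerC ?oner_eq0 ?rmorph0 ?hornerC ?mul0r //.
by move=> m; rewrite coef0 big1 // => k _; rewrite mulr0.
Qed.

Lemma ratval_delta : ratval (fun m => (m == 0%N)%:R) 1.
Proof.
exists 1, 1; split; rewrite /eval ?rmorph1 ?hornerC ?oner_eq0 ?divr1 //.
apply/expansion_trunc => -[|m] N mN; first by rewrite mul1r coef_poly mN coef1.
by rewrite mul1r coef_poly mN coef1.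
Qed.

Lemma ratvalD c d y z :
  ratval c y -> ratval d z -> ratval (fun m => c m + d m) (y + z).
Proof.
move=> [P [Q [H Q0 ->]]] [P' [Q' [H' Q0' ->]]].
exists (Q' * P + Q * P'), (Q' * Q); rewrite evalD !evalM; split.
- move=> m; rewrite coefD -(expansion_mull Q' H) -(expansion_mull Q H') -big_split.
  by apply: eq_bigr => k _; rewrite mulrDr (mulrC Q).
- by rewrite mulf_neq0.
- rewrite addf_div // (mulrC (eval P) (eval Q')) (mulrC (eval P') (eval Q)).
  by rewrite (mulrC (eval Q) (eval Q')).
Qed.

Lemma ratvalZ a c y : ratval c y -> ratval (fun m => a * c m) (phi a * y).
Proof.
move=> [P [Q [H Q0 ->]]]; exists (a *: P), Q; split=> //; last first.
  by rewrite /eval linearZ hornerZ mulrA.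
move=> m; rewrite coefZ -H mulr_sumr; apply: eq_bigr => k _; exact: mulrCA.
Qed.

Lemma ratval_sum (I : finType) (A : pred I) (c : I -> nat -> R) (y : I -> K) :
  (forall i, A i -> ratval (c i) (y i)) ->
  ratval (fun m => \sum_(i | A i) c i m) (\sum_(i | A i) y i).
Proof.
move=> H; elim: (index_enum I) => [|i s IH].
  rewrite big_nil; apply: ratval_ext ratval0 => m; by rewrite big_nil.
rewrite big_cons; case: ifP => Ai.
  by apply: ratval_ext (ratvalD (H i Ai) IH) => m; rewrite big_cons Ai.
by apply: ratval_ext IH => m; rewrite big_cons Ai.
Qed.

Lemma ratval_shift e c y : ratval c y -> ratval (shift e c) (x ^+ e * y).
Proof.
move=> [P [Q [/expansion_trunc H Q0 ->]]]; exists ('X^e * P), Q; split=> //; last first.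
  by rewrite /eval rmorphM /= map_polyXn hornerM hornerXn mulrA.
apply/expansion_trunc => m N mN; rewrite coefXnM.
have -> : (Q * \poly_(i < N) shift e c i)`_m = ('X^e * (Q * \poly_(i < N) c i))`_m.
  rewrite mulrCA !coefM; apply: eq_bigr => i _; congr (_ * _).
  have iN := leq_ltn_trans (leq_subr i m) mN.
  rewrite coefXnM coef_poly iN /shift; case: ifP => // _.
  by rewrite coef_poly (leq_ltn_trans (leq_subr _ _) iN).
by rewrite coefXnM; case: ifP => // _; rewrite H // (leq_ltn_trans (leq_subr _ _) mN).
Qed.

(** The geometric series: [c = q^k c + d] is solved by [c = d / (1 - q^k)]. *)
Lemma ratval_geometric k c d y : x ^+ k != 1 ->
  (forall m, c m = shift k c m + d m) -> ratval d y ->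
  ratval c (y / (1 - x ^+ k)).
Proof.
move=> xk cd [P [Q [/expansion_trunc H Q0 ->]]].
exists P, (Q * (1 - 'X^k)).
have E : eval (Q * (1 - 'X^k)) = eval Q * (1 - x ^+ k).
  by rewrite /eval !(rmorphM, rmorphB, rmorph1) /= map_polyXn !hornerE.
split; last 1 first.
- by rewrite E invfM mulrA.
- apply/expansion_trunc => m N mN; rewrite -(H m N mN) -mulrA !coefM.
  apply: eq_bigr => i _; congr (_ * _).
  have iN := leq_ltn_trans (leq_subr i m) mN.
  rewrite mulrBl mul1r coefB coefXnM !coef_poly iN cd /shift.
  case: ifP => _; first by rewrite subr0 add0r.
  by rewrite (leq_ltn_trans (leq_subr _ _) iN) addrAC subrr add0r.
- by rewrite E mulf_neq0 // subr_eq0 eq_sym.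
Qed.

End RationalSeries.

(** * Packing keeps exactly the relative order of the letters *)

Definition cmp {d : Order.disp_t} {T : orderType d} (x y : T) : comparison :=
  if (x < y)%O then Lt else if x == y then Eq else Gt.

Section Comparison.
Context {d : Order.disp_t} {T : orderType d}.
Implicit Types (x y : T).

Lemma cmp_refl x : cmp x x = Eq.
Proof. by rewrite /cmp ltxx eqxx. Qed.

Lemma cmp_lt x y : (x < y)%O -> cmp x y = Lt.
Proof. by rewrite /cmp => ->. Qed.

Lemma cmp_gt x y : (y < x)%O -> cmp x y = Gt.
Proof. by rewrite /cmp => xy; rewrite ltNge (ltW xy) /= gt_eqF. Qed.

Lemma cmp_ltE x y : (x < y)%O = (if cmp x y is Lt then true else false).
Proof. by rewrite /cmp; case: ltgtP. Qed.

Lemma cmp_eqE x y : (x == y) = (if cmp x y is Eq then true else false).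
Proof. by rewrite /cmp; case: ltgtP. Qed.

End Comparison.

Section Packing.
Context {d : Order.disp_t} {T : orderType d}.
Implicit Types (v : seq T) (x : T).

(** The rank of [x] is expressed without sorting: the number of distinct
    smaller letters depends only on the relative order of the letters. *)
Lemma index_sort_undup v x : x \in v ->
  index x (sort <=%O (undup v)) = size (undup [seq y <- v | (y < x)%O]).
Proof.
move=> xv; set s := sort _ _.
have xs : x \in s by rewrite mem_sort mem_undup.
have s_sorted : sorted <%O s.
  by rewrite lt_sorted_uniq_le sort_uniq undup_uniq sort_le_sorted.
rewrite -filter_undup size_filter -(count_sort <=%O) -/s.
by have := count_lt_nth x s_sorted; move/(_ (index x s)); rewrite nth_index // index_mem => ->.
Qed.

Lemma nth_pack x0 v i : (i < size v)%N ->
  nth 0%N (pack v) i =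
    (size (undup [seq y <- v | (y < nth x0 v i)%O])).+1.
Proof.
by move=> iv; rewrite (nth_map x0) // index_sort_undup // mem_nth.
Qed.

Lemma cmp_pack x0 v i j : (i < size v)%N -> (j < size v)%N ->
  cmp (nth 0%N (pack v) i) (nth 0%N (pack v) j) = cmp (nth x0 v i) (nth x0 v j).
Proof.
move=> iv jv; rewrite !(nth_pack x0) //.
set x := nth x0 v i; set y := nth x0 v j.
have mono x' y' : x' \in v -> (x' < y')%O ->
    (size (undup [seq z <- v | (z < x')%O]) <
     size (undup [seq z <- v | (z < y')%O]))%N.
  move=> x'v xy.
  rewrite -[(size _).+1]/(size (x' :: undup [seq z <- v | (z < x')%O])).
  apply: uniq_leq_size => [|z].
    by rewrite /= undup_uniq andbT mem_undup mem_filter ltxx.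
  rewrite in_cons !mem_undup !mem_filter => /predU1P[->|/andP[zx ->]].
    by rewrite xy.
  by rewrite (lt_trans zx).
case: (ltgtP x y) => [xy|yx|->]; last by rewrite !cmp_refl.
  by rewrite (cmp_lt xy) cmp_lt // ltEnat /= ltnS; apply: mono => //; exact: mem_nth.
by rewrite (cmp_gt yx) cmp_gt // ltEnat /= ltnS; apply: mono => //; exact: mem_nth.
Qed.

End Packing.

Lemma size_undup_map (I T T' : eqType) (f : I -> T) (g : I -> T') (s : seq I) :
  {in s &, forall i j, (f i == f j) = (g i == g j)} ->
  size (undup (map f s)) = size (undup (map g s)).
Proof.
elim: s => //= i s IH fg.
have -> : (f i \in map f s) = (g i \in map g s).
  apply/mapP/mapP => -[j js /eqP E]; exists j => //; apply/eqP; move: E.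
    by rewrite fg ?mem_head // in_cons js orbT.
  by rewrite fg ?mem_head // in_cons js orbT.
have {}IH : size (undup (map f s)) = size (undup (map g s)).
  by apply: IH => j k js ks; rewrite fg // in_cons ?js ?ks orbT.
by case: ifP => _ //=; rewrite IH.
Qed.

Lemma eq_pack d d' (T : orderType d) (T' : orderType d') x0 y0
    (v : seq T) (v' : seq T') :
  size v = size v' ->
  (forall i j, (i < size v)%N -> (j < size v)%N ->
    cmp (nth x0 v i) (nth x0 v j) = cmp (nth y0 v' i) (nth y0 v' j)) ->
  pack v = pack v'.
Proof.
move=> szE vv'; apply: (@eq_from_nth _ 0%N); rewrite !size_pack // => i iv.
rewrite (nth_pack x0) // (nth_pack y0) -?szE //; congr _.+1.
rewrite -{2}[v](mkseq_nth x0) -{2}[v'](mkseq_nth y0) -szE /mkseq !filter_map.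
have -> : [seq k <- iota 0 (size v) | preim (nth y0 v') (< nth y0 v' i)%O k]
        = [seq k <- iota 0 (size v) | preim (nth x0 v) (< nth x0 v i)%O k].
  by apply: eq_in_filter => k; rewrite mem_iota /= => kv; rewrite !cmp_ltE vv'.
apply: size_undup_map => j k; rewrite !mem_filter !mem_iota /= => /andP[_ jv].
by move=> /andP[_ kv]; rewrite !cmp_eqE vv'.
Qed.

Lemma pack_eqP d (T : orderType d) x0 (v : seq T) (u : seq nat) :
  packed u -> size u = size v ->
  reflect (forall i j, (i < size v)%N -> (j < size v)%N ->
             cmp (nth 0%N u i) (nth 0%N u j) = cmp (nth x0 v i) (nth x0 v j))
          (pack v == u).
Proof.
move=> /eqP pu szu; apply: (iffP eqP) => [<- i j iv jv|uv].
  exact: cmp_pack.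
by rewrite -[RHS]pu; symmetry; apply: (eq_pack szu) => i j; rewrite szu; apply: uv.
Qed.

Lemma packed_pack d (T : orderType d) (v : seq T) : packed (pack v).
Proof.
case: v => [//|x0 v]; apply/eqP; apply: (@eq_pack _ _ _ _ 0%N x0).
  exact: size_pack.
by move=> i j; rewrite size_pack => iv jv; rewrite (cmp_pack x0).
Qed.

(** * Peeling off the largest letters with exponent zero *)

Section Peeling.
Variables (n : nat) (w : 'I_n -> nat).
Implicit Types (D S : {set 'I_n}) (f : 'I_n -> nat).

Definition letter_cmp f (i i' : 'I_n) : comparison :=
  cmp ((w i, f i) : nat *l nat^d) ((w i', f i') : nat *l nat^d).

Lemma letter_cmpE f i i' :
  letter_cmp f i i' = if w i == w i' then cmp (f i') (f i) else cmp (w i) (w i').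
Proof.
rewrite /letter_cmp {1}/cmp ltxi_pair xpair_eqE.
case: (ltgtP (w i) (w i')) => //= [lt|gt|_].
- by rewrite cmp_lt.
- by rewrite cmp_gt.
- by rewrite /cmp ltEdual (eq_sym (f i)).
Qed.

Definition top D : {set 'I_n} :=
  [set i in D | [forall i' in D, (w i' <= w i)%N]].

Definition zeros D f : {set 'I_n} := [set i in top D | f i == 0%N].

Definition lower D f : 'I_n -> nat := fun i => (f i - (i \in top D))%N.

Lemma topS D : top D \subset D.
Proof. by apply/subsetP => i; rewrite inE => /andP[]. Qed.

Lemma mem_zeros D f i : (i \in zeros D f) = (i \in top D) && (f i == 0%N).
Proof. by rewrite inE. Qed.

Lemma top_max D i i' : i \in top D -> i' \in D -> (w i' <= w i)%N.
Proof. by rewrite inE => /andP[_ /forall_inP]; apply. Qed.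

Lemma top_eq D i i' : i \in top D -> i' \in D -> (i' \in top D) = (w i == w i').
Proof.
move=> iT i'D; apply/idP/eqP => [i'T|E].
  apply/eqP; rewrite eqn_leq (top_max iT i'D) (top_max i'T) //.
  exact: (subsetP (topS D)).
rewrite inE i'D /=; apply/forall_inP => k kD; rewrite -E; exact: top_max kD.
Qed.

Lemma top_neq0 D : D != set0 -> top D != set0.
Proof.
case/set0Pn => i0 i0D; apply/set0Pn.
case: (arg_maxnP (P := [in D]) w i0D) => i iD imax.
by exists i; rewrite inE iD; apply/forall_inP.
Qed.

Lemma letter_cmp_lower D f i i' :
  i \in D -> i' \in D -> i \notin zeros D f -> i' \notin zeros D f ->
  letter_cmp (lower D f) i i' = letter_cmp f i i'.
Proof.
move=> iD i'D; rewrite !letter_cmpE /zeros /lower !inE iD i'D /=.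
have [E|//] := eqVneq (w i) (w i'); rewrite -E; case: [forall _ in _, _] => /=.
  by rewrite -!lt0n /cmp => ? ?; rewrite !ltEnat /= ltn_sub2rE // eqn_sub2rE.
by rewrite !subn0.
Qed.

Definition zero_cmp S (i i' : 'I_n) : comparison :=
  if i \in S then if i' \in S then Eq else Gt else Lt.

(** A zero exponent on a largest base letter gives a largest letter, because
    the powers of [q] are in decreasing order. *)
Lemma letter_cmp_zeros D f i i' (S := zeros D f) :
  i \in D -> i' \in D -> (i \in S) || (i' \in S) ->
  letter_cmp f i i' = zero_cmp S i i'.
Proof.
have big k k' : k' \in D -> k \in S -> k' \notin S ->
    letter_cmp f k k' = Gt /\ letter_cmp f k' k = Lt.
  rewrite !inE => k'D /andP[kT /eqP fk]; rewrite k'D /=.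
  rewrite !letter_cmpE (eq_sym (w k')).
  have kT' : k \in top D by rewrite inE kT.
  have := top_eq kT' k'D; rewrite inE k'D /= => ->.
  have [_ /=|ne _] := eqVneq (w k) (w k').
    by rewrite -lt0n fk => k'0; rewrite cmp_gt // cmp_lt.
  have lt : (w k' < w k)%N by rewrite ltn_neqAle eq_sym ne (top_max kT' k'D).
  by rewrite cmp_gt // cmp_lt.
move=> iD i'D; rewrite /zero_cmp.
case: (boolP (i \in S)) => iS; case: (boolP (i' \in S)) => //= i'S _.
- move: iS i'S; rewrite !inE => /andP[iT /eqP fi] /andP[i'T /eqP fi'].
  have := @top_eq D i i'; rewrite !inE iT i'T => /(_ isT i'D) E.
  by rewrite letter_cmpE -E fi fi' cmp_refl.
- by have [] := big i i' i'D iS i'S.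
- by have [] := big i' i iD i'S iS.
Qed.

Section Weights.
Variables (R : comNzRingType) (omega : 'I_n -> 'I_n -> comparison -> R).

(** Both the indicator of a pattern [u] and the chromatic weight of a coloring
    are products of factors that see one pair of letters at a time, through
    their relative order; hence a common treatment for arbitrary [omega]. *)
Definition weight D f : R :=
  \prod_(p : 'I_n * 'I_n | (p.1 \in D) && (p.2 \in D))
     omega p.1 p.2 (letter_cmp f p.1 p.2).

Definition zero_weight D S : R :=
  \prod_(p : 'I_n * 'I_n |
           [&& p.1 \in D, p.2 \in D & (p.1 \in S) || (p.2 \in S)])
     omega p.1 p.2 (zero_cmp S p.1 p.2).

(** Lowering the exponents does not affect the relative order of the letters
    that remain, and the order of the other pairs depends only on [S]. *)
Lemma weight_zeros D f (S := zeros D f) :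
  weight D f = zero_weight D S * weight (D :\: S) (lower D f).
Proof.
rewrite /weight (bigID (fun p => (p.1 \in S) || (p.2 \in S))) /=; congr (_ * _).
  rewrite /zero_weight; apply: eq_big => [p|p /andP[/andP[pD p'D] pS]].
    by rewrite andbA.
  by rewrite (letter_cmp_zeros pD p'D).
apply: eq_big => [p|p /andP[/andP[pD p'D]]].
  by rewrite !in_setD negb_or; do 4!case: (_ \in _).
by rewrite negb_or => /andP[pS p'S]; rewrite letter_cmp_lower.
Qed.

Definition exponents N D m : pred (n.-tuple 'I_N.+1) := fun j =>
  (\sum_i tnth j i == m)%N &&
  [forall i, (i \notin D) ==> (tnth j i == 0%N :> nat)].

Definition weight_sum D m : R :=
  \sum_(j : n.-tuple 'I_m.+1 | exponents D m j) weight D (tnth j).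

Lemma exponents_le N D m (j : n.-tuple 'I_N.+1) i :
  exponents D m j -> (tnth j i <= m)%N.
Proof. by case/andP=> /eqP<- _; rewrite (bigD1 i) //= leq_addr. Qed.

Lemma weight_sum_bound N D m : (m <= N)%N ->
  \sum_(j : n.-tuple 'I_N.+1 | exponents D m j) weight D (tnth j)
    = weight_sum D m.
Proof.
move=> mN.
pose h (j : n.-tuple 'I_m.+1) : n.-tuple 'I_N.+1 := [tuple inord (tnth j i) | i < n].
pose h' (j : n.-tuple 'I_N.+1) : n.-tuple 'I_m.+1 := [tuple inord (tnth j i) | i < n].
have hE j i : tnth (h j) i = tnth j i :> nat.
  by rewrite tnth_mktuple inordK // (leq_trans (ltn_ord _)).
rewrite (reindex_onto h h') => [|j Pj]; last first.
  apply: eq_from_tnth => i; apply: ord_inj; rewrite hE tnth_mktuple inordK //.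
  by rewrite ltnS (exponents_le _ Pj).
apply: eq_big => [j|j _]; last by congr weight; apply/funext => i; rewrite hE.
have -> : h' (h j) == j.
  apply/eqP/eq_from_tnth => i; apply: ord_inj.
  by rewrite tnth_mktuple inordK hE.
rewrite andbT /exponents; under eq_bigr do rewrite hE.
by congr (_ && _); apply: eq_forallb => i; rewrite hE.
Qed.

(** The exponent sequences with set of zeros [S] arise from those on [D :\: S]
    by raising the exponents on [top D :\: S] by one. *)
Lemma weight_sum_zeros D S m : S \subset top D ->
  \sum_(j : n.-tuple 'I_m.+2 | exponents D m j && (zeros D (tnth j) == S))
     weight D (tnth j)
  = zero_weight D S * shift #|top D :\: S| (weight_sum (D :\: S)) m.
Proof.
move=> ST; set e := #|_|.
pose up i := i \in top D :\: S.
(* One more value on the left-hand side makes raising an exponent total. *)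
pose h (j : n.-tuple 'I_m.+1) : n.-tuple 'I_m.+2 :=
  [tuple inord (tnth j i + up i) | i < n].
pose h' (j : n.-tuple 'I_m.+2) : n.-tuple 'I_m.+1 :=
  [tuple inord (lower D (tnth j) i) | i < n].
have hE j i : tnth (h j) i = (tnth j i + up i)%N :> nat.
  rewrite tnth_mktuple inordK //; have := ltn_ord (tnth j i).
  by case: (up i) => /=; lia.
rewrite (reindex_onto h h') => [|j /andP[Pj /eqP jS]]; last first.
  apply: eq_from_tnth => i; apply: ord_inj; rewrite hE tnth_mktuple inordK; last first.
    by rewrite ltnS (leq_trans (leq_subr _ _)) ?(exponents_le _ Pj).
  rewrite /lower /up -jS in_setD !inE.
  case: ((i \in D) && _) => /=; last by rewrite subn0 addn0.
  by rewrite andbT; case: (nat_of_ord (tnth j i)) => //= k; rewrite subn1 addn1.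
have sum_up : (\sum_i up i = e)%N by rewrite /e -sum1_card [RHS]big_mkcond.
have low (j : n.-tuple 'I_m.+1) i : exponents (D :\: S) (m - e)%N j ->
    lower D (tnth (h j)) i = tnth j i :> nat.
  case/andP=> _ /forall_inP jD; rewrite /lower hE /up in_setD.
  case: (boolP (i \in S)) => iS /=; last by rewrite addnK.
  by rewrite (eqP (jD i _)) // in_setD iS.
have E (j : n.-tuple 'I_m.+1) :
    (exponents D m (h j) && (zeros D (tnth (h j)) == S)) && (h' (h j) == j)
         = (e <= m)%N && exponents (D :\: S) (m - e)%N j.
  rewrite {1}/exponents; under eq_bigr do rewrite hE.
  rewrite big_split /= sum_up.
  apply/idP/idP.
    case/andP=> /andP[/andP[/eqP jm /forall_inP jD] /eqP jS] _.
    have em : (e <= m)%N by rewrite -[X in (_ <= X)%N]jm leq_addl.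
    rewrite em /exponents -(eqn_add2r e) jm subnK // eqxx /=; apply/forall_inP => i.
    rewrite in_setD negb_and negbK => /orP[iS|iD].
      by move: (iS); rewrite -jS mem_zeros hE addn_eq0 => /andP[_ /andP[]].
    by have := jD i iD; rewrite hE addn_eq0 => /andP[].
  case/andP=> em Pj; have /andP[/eqP jm /forall_inP jD] := Pj.
  rewrite jm subnK // eqxx /=; apply/andP; split; [apply/andP; split|].
  - apply/forall_inP => i iD; rewrite hE addn_eq0.
    rewrite jD ?in_setD ?negb_and ?iD ?orbT //=.
    by rewrite /up in_setD (contraNF (subsetP (topS D) i) iD) andbF.
  - apply/eqP/setP => i; rewrite mem_zeros hE addn_eq0 /up in_setD.
    case: (boolP (i \in S)) => iS /=; last by case: (i \in top D); rewrite ?andbF.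
    by rewrite (subsetP ST) // (eqP (jD i _)) // in_setD iS.
  - apply/eqP/eq_from_tnth => i; apply: ord_inj.
    by rewrite tnth_mktuple (low _ _ Pj) inordK.
rewrite (eq_bigl _ _ E) /shift ltnNge; case: (leqP e m) => em /=; last first.
  by rewrite big_pred0 // mulr0.
rewrite -(weight_sum_bound _ (leq_subr e m)) mulr_sumr; apply: eq_bigr => j Pj.
have /andP[/andP[_ /eqP jS] _] := etrans (E j) (introT andP (conj em Pj)).
rewrite weight_zeros jS; congr (_ * weight _ _); apply/funext => i.
exact: low Pj.
Qed.

(** The term of the empty set involves [weight_sum D] itself, shifted: when no
    exponent on [top D] vanishes, all of them are lowered by one. *)
Lemma weight_sum_rec D m :
  weight_sum D m = \sum_(S : {set 'I_n} | S \subset top D)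
     zero_weight D S * shift #|top D :\: S| (weight_sum (D :\: S)) m.
Proof.
rewrite -(weight_sum_bound _ (leqnSn m)).
rewrite (partition_big (fun j : n.-tuple 'I_m.+2 => zeros D (tnth j))
  (fun S : {set 'I_n} => S \subset top D)).
  by apply: eq_bigr => S ST; rewrite weight_sum_zeros.
by move=> j _; apply/subsetP => i; rewrite mem_zeros => /andP[].
Qed.

End Weights.
End Peeling.

(** * Rationality of the weighted sums over exponents *)

Section WeightSumRational.
Variables (n : nat) (w : 'I_n -> nat) (R : comNzRingType).
Variables (omega : 'I_n -> 'I_n -> comparison -> R).
Variables (K : fieldType) (phi : {rmorphism R -> K}) (x : K).
Hypothesis x_not_root1 : forall k, (0 < k)%N -> x ^+ k != 1.
Implicit Types (D S : {set 'I_n}).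

Lemma zero_weight_set0 D : zero_weight omega D set0 = 1.
Proof. by rewrite /zero_weight big_pred0 // => p; rewrite !in_set0 !andbF. Qed.

Lemma weight_sum_set0 m : weight_sum w omega set0 m = (m == 0%N)%:R.
Proof.
rewrite /weight_sum.
have weight0 f : weight w omega set0 f = 1.
  by rewrite /weight big_pred0 // => p; rewrite in_set0.
case: m => [|m].
  rewrite (big_pred1 [tuple ord0 | i < n]) ?weight0 // => j /=.
  have -> : j == [tuple ord0 | i < n].
    by apply/eqP/eq_from_tnth => i; rewrite ord1 tnth_mktuple.
  rewrite /exponents big1 ?eqxx => [|i _]; last by rewrite ord1.
  by apply/forall_inP => i _; rewrite ord1.
rewrite big_pred0 // => j; apply/negP => /andP[/eqP jm /forall_inP j0].
by move: jm; rewrite big1 // => i _; apply/eqP/j0; rewrite in_set0.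
Qed.

Lemma weight_sum_step D (V : {set 'I_n} -> K) : D != set0 ->
  (forall S, S \subset top w D -> S != set0 ->
     ratval phi x (weight_sum w omega (D :\: S)) (V S)) ->
  ratval phi x (weight_sum w omega D)
    ((\sum_(S : {set 'I_n} | (S \subset top w D) && (S != set0))
        phi (zero_weight omega D S) * (x ^+ #|top w D :\: S| * V S))
     / (1 - x ^+ #|top w D|)).
Proof.
move=> D0 H; apply: ratval_geometric.
- by apply: x_not_root1; rewrite card_gt0 top_neq0.
- move=> m; rewrite weight_sum_rec (bigD1 set0) ?sub0set //=.
  by rewrite zero_weight_set0 mul1r !setD0; congr (_ + _).
- apply: ratval_sum => S /andP[ST S0].
  by apply/ratvalZ/ratval_shift/H.
Qed.

Lemma cardD_lt D S : S \subset top w D -> S != set0 ->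
  (#|D :\: S| < #|D|)%N.
Proof.
move=> ST S0; have SD := subset_trans ST (topS w D).
rewrite cardsDS // ltn_subrL card_gt0 S0 /=.
by rewrite (leq_trans _ (subset_leq_card SD)) // card_gt0.
Qed.

Lemma weight_sum_rational D : exists y, ratval phi x (weight_sum w omega D) y.
Proof.
have [k] := ubnP #|D|; elim: k D => // k IH D; rewrite ltnS => Dk.
have [->|D0] := eqVneq D set0.
  exists 1; apply: ratval_ext (ratval_delta phi x) => m.
  by rewrite weight_sum_set0.
have /choice[V HV] S : exists y, S \subset top w D -> S != set0 ->
    ratval phi x (weight_sum w omega (D :\: S)) y.
  have [/andP[ST S0]|] := boolP ((S \subset top w D) && (S != set0)).
    by have [y yP] := IH _ (leq_trans (cardD_lt ST S0) Dk); exists y.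
  by rewrite negb_and => /orP[/negbTE->|/negbTE->]; exists 0.
by eexists; apply: weight_sum_step HV.
Qed.

Lemma weight_sum_value (V : {set 'I_n} -> K) : V set0 = 1 ->
  (forall D, D != set0 ->
     V D = \sum_(S : {set 'I_n} | S \subset top w D)
             phi (zero_weight omega D S) * (x ^+ #|top w D :\: S| * V (D :\: S))) ->
  forall D, ratval phi x (weight_sum w omega D) (V D).
Proof.
move=> V0 Vrec D.
have [k] := ubnP #|D|; elim: k D => // k IH D; rewrite ltnS => Dk.
have [->|D0] := eqVneq D set0.
  by rewrite V0; apply: ratval_ext (ratval_delta phi x) => m; rewrite weight_sum_set0.
have k0 : 1 - x ^+ #|top w D| != 0.
  by rewrite subr_eq0 eq_sym x_not_root1 // card_gt0 top_neq0.
have -> : V D = (V D * (1 - x ^+ #|top w D|)) / (1 - x ^+ #|top w D|).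
  by rewrite mulfK.
rewrite mulrBr mulr1 {1}Vrec // (bigD1 set0) ?sub0set //=.
rewrite zero_weight_set0 rmorph1 mul1r !setD0 (mulrC (x ^+ _) (V D)) [X in X - _]addrC addrK.
apply: (weight_sum_step (V := fun S => V (D :\: S))) => // S ST S0.
exact: IH (leq_trans (cardD_lt ST S0) Dk).
Qed.

End WeightSumRational.

(** * Independent sets of a Dyck graph *)

Section DyckSum.
Variables (n : nat) (G : rel 'I_n) (HG : dyck_graph G) (K : fieldType) (t : K).
Implicit Types (B S : {set 'I_n}).

(** For an independent set [S] this is [t] to the number of edges from a
    vertex of [B] up to a vertex of [S]; it vanishes if [S], included in [B],
    is not independent. *)
Definition down_weight B S : K :=
  \prod_(i' in S) \prod_(i in B | (i < i')%N && G i i') (if i \in S then 0 else t).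

Lemma down_weight_sub B B' S : B' \subset B ->
  (forall i i', i \in B -> i \notin B' -> i' \in S -> (i < i')%N -> ~~ G i i') ->
  down_weight B S = down_weight B' S.
Proof.
move=> /subsetP BB' H; apply: eq_bigr => i' i'S; apply: eq_bigl => i.
case: (boolP (i \in B')) => [/BB'->//|iB'] /=.
case: (boolP (i \in B)) => //= iB; case: ltnP => //= ii'.
by apply/negbTE; apply: H.
Qed.

(** The last vertex [m] of [B] is either out of [S] or in it. In the latter
    case the weight vanishes unless the rest of [S] avoids the set [N] of the
    neighbours of [m]; and [G] being a Dyck graph, an edge from [N] up to a
    vertex of [B :\ m] forces this vertex into [N] too, so that the rest of [S]
    only sees the subgraph on [B :\ m :\: N]. Both cases are covered by
    induction, and [t^b + (t - 1) t^k t^(b - k) = t^(b + 1)]. *)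
Lemma sum_down_weight B :
  \sum_(S : {set 'I_n} | S \subset B) (t - 1) ^+ #|S| * down_weight B S
    = t ^+ #|B|.
Proof.
have [k] := ubnP #|B|; elim: k B => // k IH B; rewrite ltnS => Bk.
have [->|B0] := eqVneq B set0.
  rewrite (big_pred1 set0) => [|S]; last by rewrite subset0.
  by rewrite cards0 /down_weight big_set0 mulr1.
have /set0Pn[i0 i0B] := B0.
case: (arg_maxnP (P := [in B]) (@nat_of_ord n) i0B) => m mB mmax.
pose B' := B :\ m; pose N := [set i in B' | G i m].
have cardB : #|B| = #|B'|.+1 by rewrite (cardsD1 m) mB.
have B'B : B' \subset B by exact: subsetDl.
have NB' : N \subset B' by apply/subsetP => i; rewrite inE => /andP[].
have ltm i : i \in B' -> (i < m)%N.
  rewrite in_setD1 => /andP[im iB].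
  by rewrite ltn_neqAle im; apply: mmax.
rewrite (bigID (fun S : {set 'I_n} => m \in S)) /= addrC.
have -> : \sum_(S : {set 'I_n} | (S \subset B) && (m \notin S))
      (t - 1) ^+ #|S| * down_weight B S = t ^+ #|B'|.
  rewrite -IH; last by rewrite -cardB.
  apply: eq_big => [S|S /andP[SB mS]]; first by rewrite subsetD1.
  congr (_ * _); apply: down_weight_sub => // i i' iB iB' i'S ii'.
  have : i' \in B' by rewrite in_setD1 (memPn mS) // (subsetP SB).
  move: iB'; rewrite in_setD1 iB andbT negbK => /eqP im /ltm.
  by rewrite -im ltnNge (ltnW ii').
have -> : \sum_(S : {set 'I_n} | (S \subset B) && (m \in S))
      (t - 1) ^+ #|S| * down_weight B S = (t - 1) * t ^+ #|B'|.
  rewrite (reindex_onto (fun S => m |: S) (fun S => S :\ m)) /=; last first.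
    by move=> S /andP[_ mS]; rewrite setD1K.
  rewrite (eq_bigl (fun S : {set 'I_n} => S \subset B')) => [|S]; last first.
    rewrite subUset sub1set mB setU11 andbT /= subsetD1.
    case: (boolP (m \in S)) => mS.
      rewrite andbF; apply/negP => /andP[_ /eqP E].
      by move: mS; rewrite -E setD11.
    by rewrite setU1K // eqxx andbT.
  rewrite (bigID (fun S : {set 'I_n} => S \subset B' :\: N)) /= addrC big1; last first.
    move=> S /andP[SB' SN]; rewrite /down_weight.
    have [i iS iN] : exists2 i, i \in S & i \in N.
      move: SN; rewrite subsetD SB' /= disjoints_subset => /subsetPn[i iS].
      by rewrite in_setC negbK; exists i.
    rewrite (bigD1 m) ?setU11 //= (bigD1 i) /=; last first.
      have iB' := subsetP NB' _ iN; rewrite (subsetP B'B) // ltm //=.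
      by move: iN; rewrite inE => /andP[].
    by rewrite in_setU1 iS orbT !mul0r mulr0.
  rewrite add0r (eq_bigl (fun S : {set 'I_n} => S \subset B' :\: N)) => [|S]; last first.
    apply: andb_idl => SN; exact: subset_trans SN (subsetDl _ _).
  have -> : t ^+ #|B'| = t ^+ #|N| * t ^+ #|B' :\: N|.
    by rewrite -exprD -(cardsID N B') (setIidPr NB').
  rewrite -(IH (B' :\: N)); last first.
    apply: leq_trans Bk; rewrite cardB ltnS.
    by rewrite subset_leq_card ?subsetDl.
  rewrite !mulr_sumr; apply: eq_bigr => S SN.
  have mS : m \notin S.
    by apply/negP => /(subsetP SN); rewrite in_setD setD11 andbF.
  rewrite cardsU1 mS /= add1n exprS -!mulrA; congr (_ * _).
  rewrite (mulrCA (t ^+ #|N|)); congr (_ * _).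
  rewrite {1}/down_weight big_setU1 //=; congr (_ * _).
    rewrite (eq_bigl [in N]) => [|i].
      rewrite -prodr_const; apply: eq_bigr => i iN.
      rewrite in_setU1; case: eqP => [im|_] /=.
        by move: iN; rewrite im !inE eqxx.
      case: ifP => // iS; have := subsetP SN _ iS.
      by rewrite in_setD iN.
    rewrite !inE; case: (eqVneq i m) => [->|im] /=; first by rewrite ltnn andbF.
    case: (boolP (i \in B)) => //= iB; rewrite ltm //.
    by rewrite in_setD1 im.
  rewrite -(@down_weight_sub B).
  - apply: eq_bigr => i' i'S; apply: eq_bigr => i /and3P[iB ii' _].
    rewrite in_setU1; case: eqP => [im|//].
    have := subsetP SN _ i'S; rewrite in_setD => /andP[_ /ltm].
    by rewrite -im ltnNge (ltnW ii').
  - exact: subset_trans (subsetDl _ _) B'B.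
  - move=> i i' iB; rewrite in_setD negb_and negbK => iN i'S ii'.
    have := subsetP SN _ i'S; rewrite in_setD => /andP[i'N i'B'].
    have [im|im] := eqVneq i m; first by have := ltm _ i'B'; rewrite -im ltnNge (ltnW ii').
    have iB' : i \in B' by rewrite in_setD1 im.
    move: iN; rewrite iB' orbF => iN; apply/negP => Gii'.
    case/negP: i'N; rewrite inE i'B' /=.
    move: iN; rewrite inE iB' /= => Gim.
    by have [_ _ dyck] := HG; apply: (dyck i m) => //; [exact: ltm|exact: ltnW|exact: ltm].
by rewrite cardB exprS; ring.
Qed.

End DyckSum.

(** * The chromatic weights *)

Section ChromaticWeight.
Variables (n : nat) (G : rel 'I_n) (HG : dyck_graph G) (K : fieldType) (t : K).
Implicit Types (D S : {set 'I_n}).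

Definition edge (p : 'I_n * 'I_n) := (p.1 < p.2)%N && G p.1 p.2.

Definition color_weight (i i' : 'I_n) (c : comparison) : K :=
  if edge (i, i') then match c with Eq => 0 | Lt => t | Gt => 1 end else 1.

Definition asc_weight (i i' : 'I_n) (c : comparison) : K :=
  if edge (i, i') then match c with Lt => t | _ => 1 end else 1.

Section Values.
Variable (w : 'I_n -> nat).

Definition asc_prod D : K :=
  \prod_(p : 'I_n * 'I_n | (p.1 \in D) && (p.2 \in D))
     asc_weight p.1 p.2 (cmp (w p.1) (w p.2)).

Lemma down_weight_pairs D S : S \subset top w D ->
  down_weight G t (top w D) S =
  \prod_(p : 'I_n * 'I_n | (p.1 \in D) && (p.2 \in D))
     (if [&& edge p, p.1 \in top w D & p.2 \in S]
      then if p.1 \in S then 0 else t else 1).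
Proof.
move=> ST; rewrite /down_weight pair_big_dep /=.
rewrite (reindex (fun p => (p.2, p.1))) /=; last first.
  by exists (fun p => (p.2, p.1)) => [] [].
rewrite [RHS](bigID (fun p => [&& edge p, p.1 \in top w D & p.2 \in S])) /=.
rewrite [X in _ * X]big1 => [|p /andP[_ /negbTE->]] //; rewrite mulr1.
apply: eq_big => [[i i']|[i i']] /=; last first.
  by rewrite /edge /= => /and4P[-> -> -> ->].
rewrite /edge /=.
case: (boolP (i' \in S)) => i'S; rewrite ?andbF //=.
case: (boolP (i \in top w D)) => iT; rewrite ?andbF //= andbT.
rewrite (subsetP (topS w D) _ iT).
by rewrite (subsetP (topS w D)) ?(subsetP ST).
Qed.

(** The ascents of [w] are kept when the letters on [top w D] are refined by
    the exponents; the letters on [S] becoming larger than the other ones on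
    [top w D], the new ascents that end in [S] are the edges of [top w D]
    whose upper end is in [S]. *)
Lemma zero_weight_asc D S : S \subset top w D ->
  zero_weight color_weight D S * asc_prod (D :\: S)
    = asc_prod D * down_weight G t (top w D) S.
Proof.
move=> ST; rewrite down_weight_pairs // -big_split /=.
rewrite [RHS](bigID (fun p => (p.1 \in S) || (p.2 \in S))) /=; congr (_ * _).
  rewrite /zero_weight; apply: eq_big => [p|[i i'] /= /and3P[iD i'D]].
    by rewrite andbA.
  rewrite /color_weight /asc_weight /zero_cmp.
  case: ifP => /= e; last by rewrite mulr1.
  have SP k : k \in S -> k \in top w D by exact: (subsetP ST).
  case: (boolP (i \in S)) => iS; case: (boolP (i' \in S)) => i'S //= _.
  - by rewrite SP // mulr0.
  - rewrite andbF mulr1 /cmp ltNge leEnat (top_max (SP _ iS)) //=.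
    by case: ifP.
  - rewrite andbT; have := top_eq (SP _ i'S) iD => ->.
    rewrite /cmp; have [<-|ne] := eqVneq (w i') (w i).
      by rewrite ltxx ?eqxx mul1r.
    by rewrite lt_neqAle eq_sym ne leEnat (top_max (SP _ i'S)) // mulr1.
rewrite /asc_prod; apply: eq_big => [p|p].
  by rewrite !in_setD negb_or; do 4!case: (_ \in _).
by case/andP=> _; rewrite in_setD => /andP[/negbTE-> _]; rewrite !andbF mulr1.
Qed.

Lemma chromatic_value D : t != 0 -> (forall k, (0 < k)%N -> t ^+ k != 1) ->
  ratval idfun t^-1 (weight_sum w color_weight D)
    ((t / (t - 1)) ^+ #|D| * asc_prod D).
Proof.
move=> t0 tk.
have t1 : t - 1 != 0 by rewrite subr_eq0 -[t]expr1 tk.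
have xk k : (0 < k)%N -> t^-1 ^+ k != 1.
  by move=> k0; rewrite exprVn invr_eq1 tk.
pose V D := (t / (t - 1)) ^+ #|D| * asc_prod D.
apply: (weight_sum_value xk (V := V)) => [|{}D D0].
  by rewrite /V cards0 mul1r /asc_prod big_pred0 // => p; rewrite in_set0.
transitivity (t^-1 ^+ #|top w D| * ((t / (t - 1)) ^+ #|D| * asc_prod D) *
   \sum_(S : {set 'I_n} | S \subset top w D)
      (t - 1) ^+ #|S| * down_weight G t (top w D) S).
  by rewrite sum_down_weight // mulrAC -exprMn mulVf // expr1n mul1r.
rewrite mulr_sumr; apply: eq_bigr => S ST.
rewrite /V /= cardsDS // cardsDS; last exact: subset_trans ST (topS w D).
rewrite [RHS](_ : _ = zero_weight color_weight D S * asc_prod (D :\: S) *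
    (t^-1 ^+ (#|top w D| - #|S|) * (t / (t - 1)) ^+ (#|D| - #|S|))); last by ring.
rewrite zero_weight_asc //.
have ST' := subset_leq_card ST.
have SD' := subset_leq_card (subset_trans ST (topS w D)).
have splitX (a : K) p q : (q <= p)%N -> a ^+ p = a ^+ (p - q) * a ^+ q.
  by move=> qp; rewrite -exprD subnK.
rewrite (splitX _ _ _ ST') (splitX _ _ _ SD').
have -> : (t - 1) ^+ #|S| = ((t / (t - 1)) ^+ #|S| * t^-1 ^+ #|S|)^-1.
  by rewrite -exprMn mulrAC divff // mul1r exprVn invrK.
have : t / (t - 1) != 0 by rewrite mulf_neq0 ?invr_eq0.
move: (t / (t - 1)) => s s0.
field.
by rewrite !expf_neq0 // invr_eq0.
Qed.

End Values.

End ChromaticWeight.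

(** * Colorings as words *)

Section Colorings.
Variable n : nat.
Implicit Types (u : n.-tuple 'I_n.+1).

Lemma size_word u : size (word u) = n.
Proof. by rewrite size_map size_tuple. Qed.

Lemma nth_word u (i : 'I_n) : nth 0%N (word u) i = tnth u i.
Proof. by rewrite (nth_map ord0) ?size_tuple // -tnth_nth. Qed.

Lemma word_inj : injective (@word n).
Proof. by move=> u v /(inj_map val_inj) E; apply: val_inj. Qed.

Lemma word_of_packed (s : seq nat) : packed s -> size s = n ->
  exists2 u, u \in PW n & word u = s.
Proof.
move=> ps szs; have szu : size [seq inord x : 'I_n.+1 | x <- s] == n.
  by rewrite size_map szs.
have E : word (Tuple szu) = s.
  rewrite /word /= -map_comp -[RHS]map_id; apply/eq_in_map => x xs /=.
  by rewrite inordK // -szs pack_letter // (eqP ps).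
by exists (Tuple szu) => //; rewrite inE E.
Qed.

Lemma sum_pack (R : pzSemiRingType) d (T : orderType d) (v : seq T)
    (F : n.-tuple 'I_n.+1 -> R) : size v = n ->
  exists u, [/\ u \in PW n, word u = pack v &
    \sum_(u' in PW n) F u' * (pack v == word u')%:R = F u].
Proof.
move=> szv; have [|u uP uv] := word_of_packed (packed_pack v).
  by rewrite size_pack.
exists u; split=> //; rewrite (bigD1 u) //= -uv eqxx mulr1 big1 ?addr0 // => u' /andP[_ ne].
by rewrite (inj_eq word_inj) eq_sym (negbTE ne) mulr0.
Qed.

Section Graph.
Variables (G : rel 'I_n) (HG : dyck_graph G) (K : fieldType) (t : K).

Lemma ascE u :
  t ^+ asc G u = asc_prod G t (fun i => tnth u i) setT.
Proof.
rewrite /asc -prodr_const /asc_prod.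
rewrite [RHS](bigID (fun e : 'I_n * 'I_n => edge G e && (tnth u e.1 < tnth u e.2)%N)) /=.
rewrite [X in _ * X]big1 ?mulr1 => [|[i i'] /andP[_]] /=.
  apply: eq_big => [e|[i i']]; first by rewrite !inE /edge andbA.
  by rewrite inE /= => /and3P[ii' Gii' uu']; rewrite /asc_weight /edge /= ii' Gii' cmp_lt.
rewrite /asc_weight negb_and; case: ifP => //= _.
by rewrite /cmp ltEnat /=; case: ifP => // _ _; case: ifP.
Qed.

Lemma color_weightE u :
  \prod_(p : 'I_n * 'I_n) color_weight G t p.1 p.2 (cmp (tnth u p.1 : nat) (tnth u p.2))
    = t ^+ asc G u * (proper_coloring G u)%:R.
Proof.
have [symG _ _] := HG; have irrG i : G i i = false by have [_ ->] := HG.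
case: (boolP (proper_coloring G u)) => [/forallP pu|]; last first.
  rewrite negb_forall => /existsP[i]; rewrite negb_forall => /existsP[i'].
  rewrite negb_imply negbK mulr0 => /andP[Gii' /eqP E].
  have [ii'|i'i|E'] := ltngtP i i'.
  - by rewrite (bigD1 (i, i')) //= /color_weight /edge /= ii' Gii' E cmp_refl mul0r.
  - by rewrite (bigD1 (i', i)) //= /color_weight /edge /= i'i symG Gii' E cmp_refl mul0r.
  - by move: Gii'; rewrite (val_inj E') irrG.
rewrite mulr1 ascE /asc_prod.
apply: eq_big => [p|[i i'] _] /=; first by rewrite !in_setT.
rewrite /color_weight /asc_weight /edge /=; case: ifP => // /andP[_ Gii'].
have /forallP/(_ i')/implyP/(_ Gii') := pu i.
by rewrite -val_eqE /= cmp_eqE; case: cmp.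
Qed.

End Graph.

Section SubstWord.
Variable (ws : n.-tuple nat).
Let w i := tnth ws i.

Definition scaled_word (f : 'I_n -> nat) : seq (nat *l nat^d) :=
  zip ws [seq f i | i <- enum 'I_n].

Lemma size_scaled_word f : size (scaled_word f) = n.
Proof. by rewrite size_zip size_map size_tuple size_enum_ord minnn. Qed.

Lemma pack_scaled_wordP f u : u \in PW n ->
  reflect (forall i i' : 'I_n,
             cmp (tnth u i : nat) (tnth u i') = letter_cmp w f i i')
          (pack (scaled_word f) == word u).
Proof.
rewrite inE => pu.
have szE : size (word u) = size (scaled_word f) by rewrite size_word size_scaled_word.
have nthE (i : 'I_n) : nth ((0%N, 0%N) : nat *l nat^d) (scaled_word f) i = (w i, f i).
  rewrite nth_zip; last by rewrite size_tuple size_map size_enum_ord.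
  by rewrite (nth_map i) ?size_enum_ord // nth_ord_enum /w (tnth_nth 0%N).
apply: (iffP (pack_eqP ((0%N, 0%N) : nat *l nat^d) pu szE)) => H i i'.
  have := H i i'; rewrite size_scaled_word !ltn_ord => /(_ isT isT).
  by rewrite !nth_word !nthE.
rewrite size_scaled_word => iv i'v.
by rewrite -[i]/(val (Ordinal iv)) -[i']/(val (Ordinal i'v)) !nth_word !nthE H.
Qed.

Definition same_cmp (c c' : comparison) : bool :=
  match c, c' with Eq, Eq | Lt, Lt | Gt, Gt => true | _, _ => false end.

Lemma same_cmpP c c' : reflect (c = c') (same_cmp c c').
Proof. by case: c; case: c'; constructor. Qed.

Definition pattern_weight u (i i' : 'I_n) (c : comparison) : int :=
  (same_cmp (cmp (tnth u i : nat) (tnth u i')) c)%:R.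

Lemma pattern_weightE u f : u \in PW n ->
  weight w (pattern_weight u) setT f = (pack (scaled_word f) == word u)%:R.
Proof.
move=> uP; rewrite /weight; case: (pack_scaled_wordP f uP) => [H|H].
  by rewrite big1 // => p _; rewrite /pattern_weight H; case: letter_cmp.
have [i [i' ne]] : exists i i', cmp (tnth u i : nat) (tnth u i') <> letter_cmp w f i i'.
  apply: contrapT => H'; apply: H => i i'; apply: contrapT => ne.
  by apply: H'; exists i, i'.
rewrite (bigD1 (i, i')) ?in_setT //= /pattern_weight.
by case: same_cmpP => // _; rewrite mul0r.
Qed.

Lemma exponents_setT N m (j : n.-tuple 'I_N.+1) :
  exponents setT m j = (sumn (map val j) == m).
Proof.
rewrite /exponents sumnE big_map big_tuple [X in _ && X](_ : _ = true) ?andbT //.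
by apply/forall_inP => i; rewrite in_setT.
Qed.

End SubstWord.
End Colorings.

(** * The substitution, one word at a time *)

Section SubstSums.
Variables (s : seq nat).
Let n := size s.
Let ws : n.-tuple nat := in_tuple s.
Implicit Types (u : n.-tuple 'I_n.+1).

Lemma scaled_word_zip m (j : n.-tuple 'I_m.+1) :
  scaled_word ws (fun i => tnth j i) = zip s (map val j).
Proof. by rewrite /scaled_word -[in RHS](map_tnth_enum j) -[in RHS]map_comp. Qed.

Lemma M_q_coefE u m : u \in PW n ->
  (M_q_coef (word u) s m)%:Z =
    weight_sum (tnth ws) (pattern_weight u) setT m.
Proof.
move=> uP; rewrite /weight_sum /M_q_coef -sum1_card -natz natr_sum.
rewrite (eq_bigl (fun j : n.-tuple 'I_m.+1 => exponents setT m j &&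
   (pack (scaled_word ws (fun i => tnth j i)) == word u))); last first.
  by move=> j; rewrite inE exponents_setT scaled_word_zip.
rewrite big_mkcondr; apply: eq_bigr => j _; rewrite pattern_weightE //.
by case: eqP.
Qed.

Lemma pattern_sum (G : rel 'I_n) (HG : dyck_graph G) (K : fieldType) (t : K) m :
  \sum_(u in PC G) t ^+ asc G u * (M_q_coef (word u) s m)%:R
    = weight_sum (tnth ws) (color_weight G t) setT m.
Proof.
transitivity (\sum_(u in PW n) t ^+ asc G u * (proper_coloring G u)%:R *
    \sum_(j : n.-tuple 'I_m.+1 | exponents setT m j)
      (pack (scaled_word ws (fun i => tnth j i)) == word u)%:R).
  rewrite (eq_bigl (fun u => (u \in PW n) && proper_coloring G u)); last first.
    by move=> u; rewrite inE.
  rewrite big_mkcondr; apply: eq_bigr => u uP.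
  case: ifP => _; last by rewrite mulr0 mul0r.
  rewrite mulr1 -[X in _ * X]/((M_q_coef (word u) s m)%:Z%:~R) M_q_coefE //.
  congr (_ * _); rewrite rmorph_sum; apply: eq_bigr => j _ /=.
  by rewrite pattern_weightE // rmorph_nat.
under eq_bigr do rewrite mulr_sumr.
rewrite exchange_big /=; apply: eq_bigr => j _.
have [u [uP uE ->]] := sum_pack
  (fun u => t ^+ asc G u * (proper_coloring G u)%:R)
  (size_scaled_word ws (fun i => tnth j i)).
have /(pack_scaled_wordP _ _ uP) H : pack (scaled_word ws (fun i => tnth j i)) == word u.
  by rewrite uE.
rewrite -color_weightE // /weight; apply: eq_big => [p|p _]; last by rewrite H.
by rewrite !in_setT.
Qed.

(** The series being rational, [spec] returns its value and not the default
    value [0]. *)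
Lemma M_q_coef_rational (K : fieldType) (x : K) u :
  (forall k, (0 < k)%N -> x ^+ k != 1) -> u \in PW n ->
  rational_value (M_q_coef (word u) s) x (spec (M_q_coef (word u) s) x).
Proof.
move=> xk uP; rewrite /spec; case: xgetP => [y -> //|noval].
have [y Hy] := weight_sum_rational (tnth ws) (pattern_weight u)
  (GRing.RMorphism.clone _ _ (intr : int -> K) _) xk setT.
case: (noval y); have [P [Q [PQ Qx ->]]] := Hy.
exists P, Q; split=> // m; rewrite -PQ; apply: eq_bigr => k _.
by rewrite M_q_coefE.
Qed.

Lemma rational_value_ratval (K : fieldType) (c : nat -> nat) (x y : K) :
  rational_value c x y -> ratval idfun x (fun m => (c m)%:R) y.
Proof.
move=> [P [Q [PQ Qx ->]]]; exists (map_poly intr P), (map_poly intr Q).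
rewrite /eval !map_poly_id //; split=> // m.
rewrite coef_map -PQ /= rmorph_sum; apply: eq_bigr => k _.
by rewrite coef_map rmorphM.
Qed.

(** Both sides are the value at [1/t] of the series of all the properly
    coloring exponents: summed over their patterns on the left, peeled off on
    the right. *)
Lemma sum_spec_chromatic (G : rel 'I_n) (HG : dyck_graph G) (K : fieldType) (t : K) :
  t != 0 -> (forall k, (0 < k)%N -> t ^+ k != 1) ->
  \sum_(u in PC G) t ^+ asc G u * spec (M_q_coef (word u) s) t^-1
    = (t / (t - 1)) ^+ n * asc_prod G t (tnth ws) setT.
Proof.
move=> t0 tk; have xk k : (0 < k)%N -> t^-1 ^+ k != 1.
  by move=> k0; rewrite exprVn invr_eq1 tk.
have := chromatic_value HG (tnth ws) setT t0 tk.
rewrite cardsT card_ord => /(ratval_unique _); apply.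
apply: ratval_ext => [m|]; first exact: pattern_sum.
apply: ratval_sum => u; rewrite inE => /andP[uP _].
exact/(ratvalZ (phi := idfun))/rational_value_ratval/M_q_coef_rational.
Qed.

End SubstSums.

Lemma transcendental_pow (K : fieldType) (t : K) :
  ~ algebraicOver (ratr : rat -> K) t ->
  t != 0 /\ forall k, (0 < k)%N -> t ^+ k != 1.
Proof.
have ratr0 : ratr 0 = 0 :> K by exact: (ratr_int K 0).
have ratr1 : ratr 1 = 1 :> K by exact: (ratr_int K 1).
have ratrN1 : ratr (- 1) = - 1 :> K by exact: (ratr_int K (- 1)).
move=> transc; split=> [|k k0]; apply/negP => /eqP tE; apply: transc.
  exists 'X; first by rewrite polyX_eq0.
  have -> : map_poly ratr 'X = 'X :> {poly K}.
    by apply/polyP => i; rewrite coef_map_id0 // !coefX; case: eqP.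
  by rewrite /root hornerX tE.
exists ('X^k - 1); first by rewrite -size_poly_eq0 size_XnsubC.
have -> : map_poly ratr ('X^k - 1) = 'X^k - 1 :> {poly K}.
  apply/polyP => i; rewrite coef_map_id0 // !coefB !coefXn !coef1.
  by case: (eqVneq i k) => [->|_]; case: eqP => [E|_] /=; rewrite ?subrr ?subr0 ?sub0r.
by rewrite /root !hornerE tE subrr.
Qed.

Theorem theorem6p2 (K : fieldType) (t : K)
    (char0 : [pchar K] =i pred0)
    (t_transcendental : ~ algebraicOver (ratr : rat -> K) t)
    (n : nat) (G : rel 'I_n) (HG : dyck_graph G) :
  (t - 1) ^+ n *: alphabet_subst t (chromatic t G)
    = \sum_(u in PW n) t ^+ asc G u *: M K (word u).
Proof.
have [t0 tk] := transcendental_pow t_transcendental.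
have t1 : t - 1 != 0 by rewrite subr_eq0 -[t]expr1 tk.
apply/funext => s; rewrite fct_sumE.
transitivity ((t - 1) ^+ n * alphabet_subst t (chromatic t G) s); first by [].
transitivity (\sum_(u in PW n) t ^+ asc G u * (pack s == word u)%:R); last by [].
have chromE v : chromatic t G v = \sum_(c in PC G) t ^+ asc G c * (pack v == word c)%:R.
  by rewrite /chromatic fct_sumE.
have [sn|sn] := eqVneq (size s) n; last first.
  rewrite [RHS]big1 => [|u _]; last first.
    case: eqP => [E|_]; last by rewrite mulr0.
    by case/eqP: sn; rewrite -(size_pack s) E size_word.
  rewrite /alphabet_subst big1 ?mulr0 // => u; rewrite inE => /eqP pu.
  rewrite chromE big1 ?mul0r // => c _; case: eqP => [E|_]; last by rewrite mulr0.
  by case/eqP: sn; rewrite -(size_word u) -(size_word c) -E size_pack.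
subst n; rewrite /alphabet_subst.
have -> : \sum_(u in PW (size s)) chromatic t G (word u) * M_subst t (word u) s
  = t ^- size s * \sum_(u in PC G) t ^+ asc G u * spec (M_q_coef (word u) s) t^-1.
  rewrite mulr_sumr [RHS](eq_bigl (fun u => (u \in PW (size s)) && (u \in PC G))).
    rewrite [RHS]big_mkcondr; apply: eq_bigr => u uP.
    have pu : pack (word u) = word u by move: uP; rewrite inE => /eqP.
    rewrite chromE /M_subst size_word pu big_mkcond (bigD1 u) //= eqxx mulr1.
    rewrite big1 => [|c cu]; last first.
      by rewrite (inj_eq (@word_inj _)) eq_sym (negbTE cu) mulr0; case: ifP.
    by rewrite addr0; case: ifP => _; [rewrite mulrCA | rewrite mul0r].
  by move=> u; rewrite inE; case: (u \in PW _).
rewrite sum_spec_chromatic //.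
have [u [uP uE ->]] := sum_pack (fun u => t ^+ asc G u) (erefl (size s)).
rewrite ascE mulrA mulrA -exprVn -!exprMn.
have -> : (t - 1) * t^-1 * (t / (t - 1)) = 1 by rewrite mulrA mulfVK // divff.
rewrite expr1n mul1r; apply: eq_bigr => p _; congr asc_weight.
rewrite -!nth_word uE (cmp_pack 0%N) ?ltn_ord //.
by rewrite !(tnth_nth 0%N).
Qed.
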